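(* Let $D_n=\sum_{k=0}^n\binom{n}{k}^2\binom{2k}{k}\binom{2(n-k)}{n-k}$ for $n\ge 0$ be the Domb numbers. Let $\{B_n\}_{n\ge 0}\subset\mathbb{Q}$ be the sequence defined by $B_0=0$, $B_1=1$ and the recurrence \[ (n+1)^3B_{n+1}=2(2n+1)(5n^2+5n+2)B_n-64n^3B_{n-1}\qquad(n\ge 1). \] Then \[ \lim_{n\to\infty}\frac{B_n}{D_n}=\frac{7}{24}\zeta(3). \]
   Context: $\zeta$ denotes the Riemann zeta function. *)

(* Defs.v *)
From mathcomp Require Import all_boot all_order all_algebra.
From mathcomp Require Import all_classical all_reals all_analysis.
Set Implicit Arguments.
Unset Strict Implicit.
Unset Printing Implicit Defensive.

Import Order.TTheory GRing.Theory Num.Theory.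
Import numFieldNormedType.Exports.

Local Open Scope ring_scope.

Definition Domb (n : nat) : nat :=
  (\sum_(k < n.+1) 'C(n, k) ^ 2 * 'C(2 * k, k) * 'C(2 * (n - k), n - k))%N.

(* The Dirichlet series of the Riemann zeta function at a real argument;
   meaningful for 1 < s, the half-line on which the series converges. *)
Definition zeta (R : realType) (s : R) : R :=
  limn (series (fun k : nat => (k.+1%:R `^ s)^-1)).

(* Main.v *)
(** Besides the Domb numbers D, the recurrence has a second, slowly growing
    solution, obtained by summing the same hypergeometric summand over the
    half-integers k = n + s/2 > n (s odd) instead of over 0 <= k <= n.  With
    periodic factors removed, this is
      u_n = \sum_(s odd) 16^n n!^2 \prod_(0 <= i < n) (s + 2i + 1)
                                 / \prod_(0 <= i <= n) (s + 2i)^3,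
    a discrete form of the Bessel moment 16^n / n!^2 \int t^(2n+1) K_0(t)^4 dt.
    Both D and u satisfy the recurrence by creative telescoping.  As
    u_0 = \sum_(s odd) 1 / s^3 = 7/8 zeta(3) and u_1 = 4 u_0 - 3, it follows that
    u = u_0 D - 3 B.  Finally u_n <= 4^n u_0 whereas D_n >= 2/3 6^n, so u_n / D_n
    tends to 0 and B_n / D_n tends to u_0 / 3. *)
Require Import Defs.
From mathcomp Require Import all_boot all_order all_algebra.
From mathcomp Require Import all_classical all_reals all_analysis.
From mathcomp Require Import ring lra zify.
Set Implicit Arguments.
Unset Strict Implicit.
Unset Printing Implicit Defensive.

Import Order.TTheory GRing.Theory Num.Theory.
Import numFieldNormedType.Exports.

Local Open Scope classical_set_scope.
Local Open Scope ring_scope.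

(** * Creative telescoping for the Domb numbers *)

Definition domb_coef (F : pzSemiRingType) (n : F) : F :=
  2 * (2 * n + 1) * (5 * n ^+ 2 + 5 * n + 2).

Lemma central_binS (d : nat) :
  (d.+1 * 'C(2 * d.+1, d.+1) = 2 * (2 * d + 1) * 'C(2 * d, d))%N.
Proof.
have := mul_bin_diag (2 * d.+1) d.
rewrite [(2 * d.+1).-1](_ : _ = (2 * d).+1)%N; last by lia.
have := mul_bin_down (2 * d).+1 d; rewrite /=.
rewrite [((2 * d).+1 - d)%N](_ : _ = d.+1); last by lia.
move: ('C((2 * d).+1, d)) => x.
by lia.
Qed.

Definition domb_term (n k : nat) : nat :=
  'C(n, k) ^ 2 * 'C(2 * k, k) * 'C(2 * (n - k), n - k).

Lemma domb_term_small (n k : nat) : (n < k)%N -> domb_term n k = 0%N.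
Proof. by move=> nk; rewrite /domb_term bin_small. Qed.

(** Ratio of the summand in the upper index, cross-multiplied to stay in [nat]; the index is written
    [k + d] so that no truncated subtraction survives. *)
Lemma domb_termSn (k d : nat) :
  (d.+1 ^ 3 * domb_term (k + d).+1 k =
   2 * (k + d).+1 ^ 2 * (2 * d + 1) * domb_term (k + d) k)%N.
Proof.
rewrite /domb_term.
rewrite [((k + d).+1 - k)%N](_ : _ = d.+1); last by lia.
rewrite [(k + d - k)%N](_ : _ = d); last by lia.
have H := central_binS d.
have := mul_bin_down (k + d).+1 k; rewrite /=.
rewrite [((k + d).+1 - k)%N](_ : _ = d.+1); last by lia.
move=> H2.
transitivity ((d.+1 * 'C((k + d).+1, k)) ^ 2 * 'C(2 * k, k)
   * (d.+1 * 'C(2 * d.+1, d.+1)))%N; first by ring.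
by rewrite -H2 H; ring.
Qed.

Lemma domb_termSk (k d : nat) :
  (k.+1 ^ 3 * (2 * d + 1) * domb_term (k + d).+1 k.+1 =
   d.+1 ^ 3 * (2 * k + 1) * domb_term (k + d).+1 k)%N.
Proof.
rewrite /domb_term.
rewrite [((k + d).+1 - k)%N](_ : _ = d.+1); last by lia.
rewrite [((k + d).+1 - k.+1)%N](_ : _ = d); last by lia.
have Hd := central_binS d; have Hk := central_binS k.
have := mul_bin_left (k + d).+1 k.
rewrite [((k + d).+1 - k)%N](_ : _ = d.+1); last by lia.
move=> H2.
apply/eqP; rewrite -(eqn_pmul2l (isT : (0 < 2)%N)); apply/eqP.
transitivity ((k.+1 * 'C((k + d).+1, k.+1)) ^ 2 * (k.+1 * 'C(2 * k.+1, k.+1))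
   * (2 * (2 * d + 1) * 'C(2 * d, d)))%N; first by ring.
by rewrite H2 Hk -Hd; ring.
Qed.

Lemma domb_termSn_natr (F : pzSemiRingType) (k d : nat) :
  (d%:R + 1) ^+ 3 * (domb_term (k + d).+1 k)%:R =
  2 * (k%:R + d%:R + 1) ^+ 2 * (2 * d%:R + 1) * (domb_term (k + d) k)%:R :> F.
Proof.
have := domb_termSn k d.
move: (domb_term _ _) (domb_term _ _) => x y /(congr1 (fun i => i%:R : F)).
by rewrite -addn1 -[(k + d).+1]addn1 !(natrM, natrX, natrD).
Qed.

Lemma domb_termSk_natr (F : pzSemiRingType) (k d : nat) :
  (k%:R + 1) ^+ 3 * (2 * d%:R + 1) * (domb_term (k + d).+1 k.+1)%:R =
  (d%:R + 1) ^+ 3 * (2 * k%:R + 1) * (domb_term (k + d).+1 k)%:R :> F.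
Proof.
have := domb_termSk k d.
move: (domb_term _ _) (domb_term _ _) => x y /(congr1 (fun i => i%:R : F)).
by rewrite -addn1 -[d.+1]addn1 !(natrM, natrX, natrD).
Qed.

(* The WZ certificate, stated relative to the summand of index n + 1: relative
   to that of index n it has a pole at k = n + 1. *)
Definition domb_cert (F : fieldType) (n k : F) : F :=
  k ^+ 3 * (8 * k ^+ 3 - 24 * k ^+ 2 + 22 * k - 4 - 36 * n * k ^+ 2
    + 74 * n * k - 32 * n + 52 * n ^+ 2 * k - 52 * n ^+ 2 - 24 * n ^+ 3)
  / (2 * (n + 1) ^+ 2 * (2 * (n - k) + 1)).

(** For [k < n] every summand is a rational multiple of [domb_term n.-1 k], which leaves an identity
    of rational functions. That base term vanishes at [k = n] and [k = n.+1], so these two cases are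
    handled apart. *)
Lemma domb_telescope (F : realFieldType) (n k : nat) :
  (0 < n)%N -> (k <= n.+1)%N ->
  n.+1%:R ^+ 3 * (domb_term n.+1 k)%:R
  - domb_coef n%:R * (domb_term n k)%:R
  + 64 * n%:R ^+ 3 * (domb_term n.-1 k)%:R =
  domb_cert n%:R k.+1%:R * (domb_term n.+1 k.+1)%:R
  - domb_cert n%:R k%:R * (domb_term n.+1 k)%:R :> F.
Proof.
have n0 (m : nat) : 0 <= m%:R :> F by [].
move=> n_gt0; rewrite leq_eqVlt => /orP[/eqP->|].
  rewrite !(domb_term_small (leqnn _)) (@domb_term_small n.-1) ?ltnS ?leq_pred //.
  move: ((domb_term n.+1 n.+1)%:R : F) (n0 n) => x.
  rewrite /domb_cert /domb_coef -!natr1; move: (n%:R : F) => y y0; field.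
  by apply/and3P; split; lra.
rewrite ltnS leq_eqVlt => /orP[/eqP->|kn].
  have H1 := domb_termSn_natr F n 0; have H2 := domb_termSk_natr F n 0.
  rewrite (@domb_term_small n.-1); last by lia.
  rewrite !addn0 in H1 H2; move: H1 H2.
  move: ((domb_term n n)%:R : F) ((domb_term n.+1 n)%:R : F)
    ((domb_term n.+1 n.+1)%:R : F) (n0 n) => t0 t1 t2.
  rewrite /domb_cert /domb_coef -(@natr1 F n).
  move: (n%:R : F) => y y0 H1 H2.
  have y1 : y + 1 != 0 by lra.
  have {}H2 : t2 = (2 * y + 1) * t1 / (y + 1) ^+ 3.
    by apply: (canRL (mulfK _)); [rewrite expf_neq0|lra].
  have {}H1 : t1 = 2 * (y + 1) ^+ 2 * t0 by lra.
  rewrite H2 H1; field.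
  by apply/and3P; split; lra.
have [d ->] : exists d, n = (k + d).+1 by exists (n - k).-1; lia.
have := domb_termSn_natr F k d; have := domb_termSn_natr F k d.+1.
have := domb_termSk_natr F k d.+1.
rewrite /domb_cert /domb_coef [(k + d).+1.-1]/= !addnS.
move: ((domb_term (k + d) k)%:R : F) ((domb_term (k + d).+1 k)%:R : F)
  ((domb_term (k + d).+2 k)%:R : F) ((domb_term (k + d).+2 k.+1)%:R : F)
  => t0 t1 t2 t3.
rewrite -(@natr1 F (k + d).+1) -(@natr1 F (k + d)) -(@natr1 F k) -(@natr1 F d).
rewrite natrD.
move: (n0 k) (n0 d); move: (k%:R : F) (d%:R : F) => x y x0 y0 H3 H2 H1.
have x1 : x + 1 != 0 by lra.
have y1 : y + 1 != 0 by lra.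
have y2 : y + 1 + 1 != 0 by lra.
have y3 : 2 * (y + 1) + 1 != 0 by lra.
have {}H3 : t3 = (y + 1 + 1) ^+ 3 * (2 * x + 1) * t2
    / ((x + 1) ^+ 3 * (2 * (y + 1) + 1)).
  by apply: (canRL (mulfK _)); [rewrite !mulf_neq0 // expf_neq0|lra].
have {}H2 : t2 = 2 * (x + y + 1 + 1) ^+ 2 * (2 * (y + 1) + 1) * t1
    / (y + 1 + 1) ^+ 3.
  by apply: (canRL (mulfK _)); [rewrite expf_neq0|lra].
have {}H1 : t1 = 2 * (x + y + 1) ^+ 2 * (2 * y + 1) * t0 / (y + 1) ^+ 3.
  by apply: (canRL (mulfK _)); [rewrite expf_neq0|lra].
rewrite H3 H2 H1; field.
by rewrite y1 y2 x1 /=; apply/and3P; split; lra.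
Qed.

(** Padding with zero terms gives the three sums of the recurrence a common range. *)
Lemma Domb_widen (n m : nat) : (n <= m)%N ->
  Domb n = (\sum_(0 <= k < m.+1) domb_term n k)%N.
Proof.
move=> nm; rewrite (big_cat_nat (n := n.+1)) //= -[LHS]addn0 big_mkord.
congr addn; rewrite big_nat big1 // => k /andP[nk _].
exact: domb_term_small.
Qed.

Lemma Domb_rec (F : realFieldType) (n : nat) : (0 < n)%N ->
  n.+1%:R ^+ 3 * (Domb n.+1)%:R =
  domb_coef n%:R * (Domb n)%:R - 64 * n%:R ^+ 3 * (Domb n.-1)%:R :> F.
Proof.
move=> n_gt0; apply/eqP; rewrite -subr_eq0 opprB addrA.
rewrite (Domb_widen (leqnn _)) (Domb_widen (leqnSn n)).
rewrite (@Domb_widen n.-1 n.+1); last by lia.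
rewrite !natr_sum !big_distrr /= addrAC -sumrB -big_split /=.
rewrite (eq_big_nat _ _ (F2 := fun k =>
  domb_cert n%:R k.+1%:R * (domb_term n.+1 k.+1)%:R
  - domb_cert n%:R k%:R * (domb_term n.+1 k)%:R)); last first.
  by move=> k /andP[_ kn]; rewrite -domb_telescope.
(* Both boundary terms vanish: the upper one because [n.+2 > n.+1], the lower one through the factor
   [k ^+ 3] of the certificate. *)
rewrite telescope_sumr // domb_term_small // mulr0 sub0r.
by rewrite /domb_cert expr0n /= !mul0r oppr0.
Qed.

(** * Exponential lower bound for the Domb numbers *)

Lemma exp3_le_central_bin (n : nat) : (2 * 3 ^ n <= 3 * 'C(2 * n, n))%N.
Proof.
(* The ratio 4 - 2 / (n + 1) of consecutive central binomials reaches 3 only from n = 1 on; equality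
   at n = 1 dictates the constant 2/3. *)
case: n => // n; elim: n => // n IHn.
have H := central_binS n.+1; rewrite -(leq_pmul2l (isT : 0 < n.+2)%N).
rewrite [X in (_ <= X)%N]mulnCA H expnS.
move: IHn; move: (_ ^ _)%N ('C(_, _)) => x y; nia.
Qed.

Lemma exp2_le_central_bin (n : nat) : (2 ^ n <= 'C(2 * n, n))%N.
Proof.
elim: n => // n IHn.
have H := central_binS n; rewrite -(leq_pmul2l (isT : 0 < n.+1)%N) H expnS.
move: IHn; move: (_ ^ _)%N ('C(_, _)) => x y; nia.
Qed.

Lemma sum_sqr_bin (n : nat) : (\sum_(k < n.+1) 'C(n, k) ^ 2 = 'C(2 * n, n))%N.
Proof.
rewrite mul2n -addnn -binomial.Vandermonde; apply: eq_bigr => k _.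
by rewrite bin_sub // -ltnS.
Qed.

(** The two central binomials of each summand contribute at least 2^k 2^(n-k) = 2^n, and the squares
    left over sum to 'C(2n, n), at least 2/3 3^n. *)
Lemma Domb_ge (n : nat) : (2 * 6 ^ n <= 3 * Domb n)%N.
Proof.
have H : (2 ^ n * 'C(2 * n, n) <= Domb n)%N.
  rewrite -sum_sqr_bin big_distrr /=; apply: leq_sum => k _.
  have kn : (k <= n)%N by rewrite -ltnS.
  rewrite -mulnA mulnC leq_mul2l.
  have -> : (2 ^ n = 2 ^ k * 2 ^ (n - k))%N by rewrite -expnD subnKC.
  by rewrite leq_mul ?exp2_le_central_bin ?orbT.
rewrite (expnMn 2 3) mulnCA (leq_trans (n := 2 ^ n * (3 * 'C(2 * n, n)))) //.
  by rewrite leq_mul2l exp3_le_central_bin orbT.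
by rewrite mulnCA leq_mul2l H orbT.
Qed.

(** * The summand of the slow solution: telescoping and estimates *)

Definition slow_term (F : fieldType) (n : nat) (s : F) : F :=
  (\prod_(i < n) (16 * (i%:R + 1) ^+ 2 * (s + 2 * i%:R + 1)
     / (s + 2 * i%:R + 2) ^+ 3)) / s ^+ 3.

Lemma slow_term0 (F : fieldType) (s : F) : slow_term 0 s = s ^- 3.
Proof. by rewrite /slow_term big_ord0 mul1r. Qed.

Lemma slow_termS (F : fieldType) (n : nat) (s : F) :
  slow_term n.+1 s = slow_term n s *
    (16 * (n%:R + 1) ^+ 2 * (s + 2 * n%:R + 1) / (s + 2 * n%:R + 2) ^+ 3).
Proof. by rewrite /slow_term big_ord_recr /= mulrAC. Qed.

(** Under s -> s + 2 each product loses its first factor and gains one at the end. With [slow_termS]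
    this makes all terms of [slow_telescope] rational multiples of a single one. *)
Lemma slow_term_shift (F : realFieldType) (n : nat) (s : F) : 0 < s ->
  slow_term n (s + 2) = slow_term n s *
    ((s + 2 * n%:R + 1) * s ^+ 3 / ((s + 1) * (s + 2 * n%:R + 2) ^+ 3)).
Proof.
move=> s0; elim: n => [|n IHn].
  by rewrite !slow_term0; field; apply/and3P; split; lra.
rewrite !slow_termS IHn -(@natr1 F n); have : 0 <= n%:R :> F by [].
move: (n%:R : F) (slow_term n s) => x y x0; field.
by repeat (apply/andP; split); lra.
Qed.

(* Thanks to the factor s - 1, summation over the odd s >= 1 leaves no boundary
   term, so that the sum satisfies the homogeneous recurrence. *)
Definition slow_cert (F : fieldType) (n s : F) : F :=
  (s - 1) * (2 + s - s ^+ 3 + 6 * n - n * s - 9 * n * s ^+ 2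
    - 26 * n ^+ 2 * s - 24 * n ^+ 3) / (s + 2 * n - 1).

Lemma slow_telescope (F : realFieldType) (n : nat) (s : F) :
  (0 < n)%N -> 0 < s ->
  n.+1%:R ^+ 3 * slow_term n.+1 s
  - domb_coef n%:R * slow_term n s
  + 64 * n%:R ^+ 3 * slow_term n.-1 s =
  slow_cert n%:R (s + 2) * slow_term n (s + 2)
  - slow_cert n%:R s * slow_term n s :> F.
Proof.
case: n => // n _ s0; rewrite slow_term_shift // !slow_termS /=.
rewrite /slow_cert /domb_coef -!(@natr1 F n.+1) -!(@natr1 F n).
have : 0 <= n%:R :> F by [].
move: (n%:R : F) (slow_term n s) => x y x0; field.
by repeat (apply/andP; split); lra.
Qed.

Lemma slow_term_gt0 (F : realFieldType) (n : nat) (s : F) :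
  0 < s -> 0 < slow_term n s.
Proof.
move=> s0; rewrite /slow_term divr_gt0 ?exprn_gt0 // prodr_gt0 // => i _.
have i0 : 0 <= i%:R :> F by [].
have h1 : 0 < s + 2 * i%:R + 1 by lra.
have h2 : 0 < s + 2 * i%:R + 2 by lra.
have h3 : 0 < i%:R + 1 :> F by lra.
by rewrite divr_gt0 ?exprn_gt0 // !mulr_gt0 ?exprn_gt0 //.
Qed.

(** In the ratio, 16 (n + 1)^2 = 4 (2n + 2)^2 is at most 4 (s + 2n + 2)^2. *)
Lemma slow_termS_le (F : realFieldType) (n : nat) (s : F) : 0 < s ->
  slow_term n.+1 s <= 4 * slow_term n s.
Proof.
move=> s0; rewrite slow_termS mulrC ler_wpM2r ?(ltW (slow_term_gt0 _ _)) //.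
have : 0 <= n%:R :> F by [].
move: (n%:R : F) => x x0.
rewrite ler_pdivrMr ?exprn_gt0; [|lra..].
have h : 4 * (x + 1) ^+ 2 <= (s + 2 * x + 2) ^+ 2 by nra.
have : (s + 2 * x + 1) * (4 * (x + 1) ^+ 2)
    <= (s + 2 * x + 2) * (s + 2 * x + 2) ^+ 2.
  by apply: ler_pM => //; try lra; nra.
by lra.
Qed.

Lemma slow_term_le (F : realFieldType) (n m : nat) (s : F) : 0 < s ->
  slow_term (m + n) s <= 4 ^+ n * slow_term m s.
Proof.
move=> s0; elim: n => [|n IHn]; first by rewrite addn0 mul1r.
rewrite addnS exprS -mulrA (le_trans (slow_termS_le _ s0)) //.
by rewrite ler_wpM2l.
Qed.

Lemma slow_term1_le (F : realFieldType) (s : F) : 1 <= s ->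
  slow_term 1 s <= 16 / s ^+ 5.
Proof.
move=> s1; rewrite slow_termS slow_term0 mulr0 !addr0 add0r expr1n mulr1.
have -> : 16 / s ^+ 5 = s ^- 3 * (16 / s ^+ 2) by field; lra.
rewrite ler_wpM2l ?invr_ge0 ?exprn_ge0 //; first lra.
rewrite ler_pdivrMr ?exprn_gt0; [|lra..].
rewrite mulrAC ler_pdivlMr ?exprn_gt0; [|lra..].
have : 0 <= s ^+ 2 by rewrite exprn_ge0 //; lra.
by rewrite !exprS expr0; nra.
Qed.

(** The quotient (s - 1) / (s + 2n - 1) is at most 1. The constants add up the absolute values of
    the coefficients of each power of n, every power of s being at most s^3. *)
Lemma slow_cert_le (F : realFieldType) (n s : F) : 0 <= n -> 1 <= s ->
  `|slow_cert n s| <= (4 + 16 * n + 26 * n ^+ 2 + 24 * n ^+ 3) * s ^+ 3.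
Proof.
move=> n0 s1; rewrite /slow_cert mulrAC normrM mulrC -[leRHS]mulr1.
have n2 : 0 <= n ^+ 2 by rewrite exprn_ge0.
have n3 : 0 <= n ^+ 3 by rewrite exprn_ge0.
have s2 : s <= s ^+ 2 by nra.
have s3 : s ^+ 2 <= s ^+ 3 by rewrite [leRHS]exprS; nra.
apply: ler_pM => //.
  have := ler_wpM2l n0 s2; have := ler_wpM2l n0 s3; have := ler_wpM2l n0 s1.
  have := ler_wpM2l n2 s2; have := ler_wpM2l n2 s3; have := ler_wpM2l n2 s1.
  have := ler_wpM2l n3 s2; have := ler_wpM2l n3 s3; have := ler_wpM2l n3 s1.
  by rewrite ler_norml; move=> *; apply/andP; split; lra.
(* For s = 1 and n = 0 the denominator is zero. *)
have [->|sn] := eqVneq s 1; first by rewrite subrr mul0r normr0.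
rewrite ger0_norm ?divr_ge0 //; [|lra..].
by rewrite ler_pdivrMr; lra.
Qed.

(** * Convergence of the sums over odd s *)

Lemma cvgn_telescope (R : numFieldType) (h : R ^nat) (l : R) :
  h @ \oo --> l -> series (telescope h) @ \oo --> l - h 0%N.
Proof. by move=> hl; rewrite telescopeK; apply: cvgB => //; exact: cvg_cst. Qed.

(** Comparison with the telescoping series of 2 / ((k + 1) (k + 2)). *)
Lemma is_cvg_series_inv_cube (R : realType) :
  cvgn (series (fun k : nat => k.+1%:R ^- 3 : R)).
Proof.
pose v : R ^nat := telescope (fun k => - 2 * harmonic k).
have v_ge (k : nat) : k.+1%:R ^- 3 <= v k.
  rewrite /v /telescope /= -(@natr1 R k.+1) -(@natr1 R k).
  have : 0 <= k%:R :> R by [].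
  move: (k%:R : R) => x x0.
  have -> : - 2 * (x + 1 + 1)^-1 - - 2 * (x + 1)^-1
      = 2 / ((x + 1 + 1) * (x + 1)).
    by field; apply/andP; split; lra.
  rewrite ler_pdivlMr ?mulr_gt0 //; [|lra..].
  rewrite mulrC ler_pdivrMr ?exprn_gt0 //; last lra.
  by rewrite !exprS expr0; nra.
have p0 (k : nat) : 0 <= k.+1%:R ^- 3 :> R by rewrite invr_ge0 exprn_ge0.
apply: (series_le_cvg p0 _ v_ge) => [k|]; first exact: le_trans (v_ge k).
by apply/cvgP/cvgn_telescope; apply: cvgM; [exact: cvg_cst|exact: cvg_harmonic].
Qed.

Definition slow_seq (R : realType) (n : nat) : R ^nat :=
  fun j => slow_term n (2 * j%:R + 1).

Definition slow (R : realType) (n : nat) : R := limn (series (@slow_seq R n)).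

Lemma slow_seq_ge0 (R : realType) (n j : nat) : 0 <= slow_seq R n j.
Proof.
by apply/ltW/slow_term_gt0; rewrite ltr_wpDl // mulr_ge0.
Qed.

Lemma slow_seq_le (R : realType) (n j : nat) :
  slow_seq R n j <= 4 ^+ n * slow_seq R 0 j.
Proof.
rewrite -[n in leLHS]add0n; apply: slow_term_le.
by rewrite ltr_wpDl // mulr_ge0.
Qed.

Lemma is_cvg_slow0 (R : realType) : cvgn (series (@slow_seq R 0)).
Proof.
apply: (series_le_cvg (@slow_seq_ge0 R 0) _ _ (@is_cvg_series_inv_cube R)) => j.
  by rewrite invr_ge0 exprn_ge0.
rewrite /slow_seq slow_term0 -natr1.
have j0 : 0 <= j%:R :> R by [].
rewrite lef_pV2 ?posrE ?exprn_gt0 //; [|lra..].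
by rewrite lerXn2r ?nnegrE; lra.
Qed.

Lemma is_cvg_slow (R : realType) (n : nat) : cvgn (series (@slow_seq R n)).
Proof.
apply: (series_le_cvg (@slow_seq_ge0 R n) _ (@slow_seq_le R n)) => [j|].
  by rewrite mulr_ge0 ?exprn_ge0 ?slow_seq_ge0.
exact: (is_cvg_seriesZ (k := 4 ^+ n) (@is_cvg_slow0 R)).
Qed.

Lemma slow_ge0 (R : realType) (n : nat) : 0 <= slow R n.
Proof.
apply: limr_ge; first exact: is_cvg_slow.
by apply: nearW => N; apply: sumr_ge0 => j _; exact: slow_seq_ge0.
Qed.

Lemma slow_le (R : realType) (n : nat) : slow R n <= 4 ^+ n * slow R 0.
Proof.
have <- : limn (series (4 ^+ n *: slow_seq R 0)) = 4 ^+ n * slow R 0.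
  exact: (lim_seriesZ (4 ^+ n) (@is_cvg_slow0 R)).
apply: lim_series_le; [exact: is_cvg_slow| |exact: slow_seq_le].
exact: (is_cvg_seriesZ (k := 4 ^+ n) (@is_cvg_slow0 R)).
Qed.

(** * Initial values of the slow solution *)

Lemma slow0 (R : realType) : slow R 0 = 7 / 8 * zeta (3 : R).
Proof.
pose f (k : nat) : R := k.+1%:R ^- 3.
have zetaE : zeta (3 : R) = limn (series f).
  rewrite /zeta; congr (limn (series _)); apply/funext => k.
  by rewrite /f (@powR_mulrn R k.+1%:R 3).
have fz : series f @ \oo --> zeta (3 : R).
  by rewrite zetaE; exact: is_cvg_series_inv_cube.
have f2z : series f \o muln 2 @ \oo --> zeta (3 : R).
  by apply: cvg_comp fz; exact: cvg_mulnl.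
(* Among the first 2N terms, the odd denominators give the series of [slow R 0] and the even ones an
   eighth of the first N terms. *)
have f2E : series f \o muln 2 =
    (fun N => series (@slow_seq R 0) N + 8^-1 * series f N).
  apply/funext => N /=; rewrite /series /=; elim: N => [|N IHN].
    by rewrite muln0 !big_geq // mulr0 addr0.
  rewrite mulnS !big_nat_recr //= IHN /slow_seq slow_term0 /f.
  rewrite mulrDr [RHS]addrACA -[LHS]addrA; congr (_ + _).
  rewrite -(@natr1 R (2 * N).+1) -(@natr1 R (2 * N)) -(@natr1 R N) natrM.
  have : 0 <= N%:R :> R by [].
  move: (N%:R : R) => x x0; field.
  by repeat (apply/andP; split); lra.
have : slow R 0 + 8^-1 * zeta (3 : R) = zeta (3 : R).
  rewrite f2E in f2z; apply: cvg_unique f2z => //.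
  by apply: cvgD; [exact: is_cvg_slow|apply: cvgM => //; exact: cvg_cst].
lra.
Qed.

(** By partial fractions, 16 (s + 1) / (s^3 (s + 2)^3) - 4 / s^3 = g(s + 2) - g(s) with g(s) = 2 /
    s^3 + 1 / s^2, and g(1) = 3. *)
Lemma slow1 (R : realType) : slow R 1 = 4 * slow R 0 - 3.
Proof.
pose t (j : nat) : R := 2 * j%:R + 1.
pose h (j : nat) : R := 2 * t j ^- 3 + t j ^- 2.
have hz : h @ \oo --> (0 : R).
  apply: (squeeze_cvgr (f := fun=> 0) (h := fun j => 3 * harmonic j)).
  - apply: nearW => j; rewrite /h /t /= -(@natr1 R j).
    have : 0 <= j%:R :> R by [].
    move: (j%:R : R) => x x0.
    have h1 : 0 < 2 * x + 1 by lra.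
    have hb : (2 * x + 1)^-1 <= (x + 1)^-1.
      by rewrite lef_pV2 ?posrE; lra.
    have h2 : 0 < (2 * x + 1)^-1 by rewrite invr_gt0.
    have h3 : (2 * x + 1)^-1 <= 1 by rewrite invf_le1 //; lra.
    rewrite -!exprVn; move: ((2 * x + 1)^-1) h2 h3 hb => y y0 y1 hb.
    have y2 : y ^+ 2 <= y by nra.
    have y3 : y ^+ 3 <= y ^+ 2 by rewrite exprS; nra.
    have y30 : 0 <= y ^+ 3 by rewrite exprn_ge0 ?ltW.
    have y20 : 0 <= y ^+ 2 by rewrite exprn_ge0 ?ltW.
    by apply/andP; split; lra.
  - exact: cvg_cst.
  - rewrite -[X in _ --> X](mulr0 3).
    by apply: cvgM; [exact: cvg_cst|exact: cvg_harmonic].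
have hl := cvgn_telescope hz.
have E : series (@slow_seq R 1) =
    (fun N => 4 * series (@slow_seq R 0) N + series (telescope h) N).
  apply/funext => N; rewrite /series /= big_distrr -big_split /=.
  apply: eq_bigr => j _; rewrite /slow_seq /telescope slow_termS slow_term0 /=.
  rewrite /h /t -(@natr1 R j).
  have : 0 <= j%:R :> R by [].
  move: (j%:R : R) => x x0; rewrite mulr0 !addr0 add0r; field.
  by repeat (apply/andP; split); lra.
have h0 : h 0%N = 3 by rewrite /h /t mulr0 add0r !expr1n; lra.
have := @is_cvg_slow R 1; rewrite -/(slow R 1) {1}E => h1.
apply: cvg_unique h1 _ => //.
apply: cvgD; first by apply: cvgM; [exact: cvg_cst|exact: is_cvg_slow0].
by move: hl; rewrite h0 sub0r.
Qed.

(** * Recurrence for the slow solution *)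

Lemma cvg_slow_cert (R : realType) (n : nat) : (0 < n)%N ->
  slow_cert n%:R (2 * N%:R + 1) * slow_seq R n N @[N --> \oo] --> (0 : R).
Proof.
case: n => // n _.
pose K : R :=
  (4 + 16 * n.+1%:R + 26 * n.+1%:R ^+ 2 + 24 * n.+1%:R ^+ 3) * 4 ^+ n * 16.
have K0 : 0 <= K.
  by rewrite !mulr_ge0 ?exprn_ge0 // !addr_ge0 // mulr_ge0 // exprn_ge0.
apply: norm_cvg0.
apply: (squeeze_cvgr (f := fun=> 0) (h := fun j => K * harmonic j)).
- apply: nearW => j; rewrite normr_ge0 /=.
  have j0 : 0 <= j%:R :> R by [].
  have s1 : 1 <= 2 * j%:R + 1 :> R by lra.
  have s0 : 0 < 2 * j%:R + 1 :> R by lra.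
  rewrite normrM (ger0_norm (slow_seq_ge0 _ _ _)).
  have h1 := slow_cert_le (ler0n _ n.+1) s1.
  (* Starting from index 1 matters: its decay s^-5 beats the growth s^3 of the certificate, whereas
     index 0 only gives s^-3. *)
  have := slow_term_le n 1 s0; rewrite add1n => h2.
  have h3 := slow_term1_le s1.
  have h4 := le_trans h2 (ler_wpM2l (exprn_ge0 n (ler0n _ 4)) h3).
  apply: le_trans (ler_pM (normr_ge0 _) (slow_seq_ge0 R n.+1 j) h1 h4) _.
  set s := 2 * j%:R + 1 in s1 s0 *.
  have -> : (4 + 16 * n.+1%:R + 26 * n.+1%:R ^+ 2 + 24 * n.+1%:R ^+ 3)
      * s ^+ 3 * (4%:R ^+ n * (16 / s ^+ 5)) = K / s ^+ 2.
    by rewrite /K; move: (n.+1%:R : R) => x; field; lra.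
  rewrite ler_wpM2l // lef_pV2 ?posrE ?exprn_gt0 //.
  by rewrite -natr1 exprS; move: s1; rewrite /s; nra.
- exact: cvg_cst.
- rewrite -[X in _ --> X](mulr0 K).
  by apply: cvgM; [exact: cvg_cst|exact: cvg_harmonic].
Qed.

Lemma slow_rec (R : realType) (n : nat) : (0 < n)%N ->
  n.+1%:R ^+ 3 * slow R n.+1 =
  domb_coef n%:R * slow R n - 64 * n%:R ^+ 3 * slow R n.-1.
Proof.
move=> n_gt0; apply/eqP; rewrite -subr_eq0 opprB addrA addrAC; apply/eqP.
have h := @cvg_slow_cert R _ n_gt0.
apply: cvg_unique h => //.
(* The partial sums satisfy the recurrence up to the upper boundary term alone, as the certificate
   vanishes at s = 1. *)
have -> : (fun N => slow_cert n%:R (2 * N%:R + 1) * slow_seq R n N) =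
  (fun N => n.+1%:R ^+ 3 * series (@slow_seq R n.+1) N
   - domb_coef n%:R * series (@slow_seq R n) N
   + 64 * n%:R ^+ 3 * series (@slow_seq R n.-1) N).
  apply/funext => N; rewrite /series /= !big_distrr /= -sumrB -big_split /=.
  rewrite (eq_bigr (fun j => slow_cert n%:R (2 * j.+1%:R + 1) * slow_seq R n j.+1
    - slow_cert n%:R (2 * j%:R + 1) * slow_seq R n j)).
    rewrite telescope_sumr // [X in _ - X](_ : _ = 0) ?subr0 //.
    by rewrite /slow_cert mulr0 add0r subrr !mul0r.
  move=> j _; rewrite /slow_seq slow_telescope // ?ltr_wpDl ?mulr_ge0 //.
  by rewrite (_ : 2 * j.+1%:R + 1 = 2 * j%:R + 1 + 2) // -natr1; ring.
by apply: cvgD; [apply: cvgB|]; apply: cvgM; try exact: cvg_cst; exact: is_cvg_slow.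
Qed.

(** * Comparison of the three solutions and the limit *)

Theorem theorem1p1 (R : realType) (B : nat -> rat)
    (B0 : B 0%N = 0) (B1 : B 1%N = 1)
    (Brec : forall n : nat, (1 <= n)%N ->
      n.+1%:R ^+ 3 * B n.+1 =
        2 * (2 * n%:R + 1) * (5 * n%:R ^+ 2 + 5 * n%:R + 2) * B n
        - 64 * n%:R ^+ 3 * B n.-1) :
  (ratr (B n) / (Domb n)%:R : R) @[n --> \oo] --> 7 / 24 * zeta (3 : R).
Proof.
pose b n : R := ratr (B n).
have ratr_rec (x y u v w : rat) :
    y ^+ 3 * u = domb_coef x * v - 64 * x ^+ 3 * w ->
    ratr y ^+ 3 * ratr u =
      domb_coef (ratr x) * ratr v - 64 * ratr x ^+ 3 * ratr w :> R.
  move=> h; transitivity (ratr (y ^+ 3 * u) : R); first by ring.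
  by rewrite h /domb_coef; ring.
have b_rec n : (0 < n)%N -> n.+1%:R ^+ 3 * b n.+1 =
    domb_coef n%:R * b n - 64 * n%:R ^+ 3 * b n.-1.
  by move=> /Brec /ratr_rec; rewrite !ratr_nat.
have Domb0 : Domb 0 = 1%N by rewrite /Domb big_ord1.
have Domb1 : Domb 1 = 4%N by rewrite /Domb !big_ord_recr big_ord0.
(* Both sides solve the same second-order recurrence, hence the induction on two consecutive
   values. *)
have slowE n : slow R n = slow R 0 * (Domb n)%:R - 3 * b n.
  suff : slow R n = slow R 0 * (Domb n)%:R - 3 * b n /\
    slow R n.+1 = slow R 0 * (Domb n.+1)%:R - 3 * b n.+1 by case.
  elim: n => [|n [IH0 IH1]].
    by rewrite /b B0 B1 Domb0 Domb1 rmorph0 rmorph1 slow1; split; ring.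
  split=> //; apply: (@mulfI _ (n.+2%:R ^+ 3)); first by rewrite expf_neq0.
  rewrite slow_rec // [n.+1.-1]/= IH1 IH0.
  rewrite [RHS]mulrBr [in RHS](mulrCA _ (slow R 0)) [in RHS](mulrCA _ 3).
  by rewrite Domb_rec // b_rec // [n.+1.-1]/=; ring.
have D0 n : 0 < (Domb n)%:R :> R.
  by rewrite ltr0n; have := Domb_ge n; have := expn_gt0 6 n; lia.
have E : (fun n => ratr (B n) / (Domb n)%:R : R) =
    (fun n => 3^-1 * (slow R 0 - slow R n / (Domb n)%:R)).
  apply/funext => n; rewrite (slowE n) -/(b n); have := D0 n.
  by move=> /lt0r_neq0 d0; field.
rewrite E (_ : _ * zeta (3 : R) = 3^-1 * (slow R 0 - 0)); last first.
  by rewrite slow0; field.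
apply: cvgM; first exact: cvg_cst.
apply: cvgB; first exact: cvg_cst.
(* The ratio 2/3 is 4/6, from [slow_le] and [Domb_ge]; the factor 3/2 inverts the constant of
   [Domb_ge]. *)
apply: (squeeze_cvgr (f := fun=> 0) (h := geometric (3 / 2 * slow R 0) (2 / 3))).
- apply: nearW => n; rewrite divr_ge0 ?slow_ge0 //=.
  rewrite ler_pdivrMr // (le_trans (slow_le _ _)) //.
  have := Domb_ge n; rewrite -(ler_nat R) !natrM natrX => h.
  rewrite (_ : 4 ^+ n = (2 / 3) ^+ n * 6 ^+ n); last first.
    by rewrite -exprMn; congr (_ ^+ n); field.
  have p : 0 <= (2 / 3) ^+ n * slow R 0 by rewrite mulr_ge0 ?slow_ge0 ?exprn_ge0.
  have := ler_wpM2l p h; lra.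
- exact: cvg_cst.
- by apply: cvg_geometric; rewrite ger0_norm //; lra.
Qed.
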